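(* Let $G$ be a connected finite simple graph. If there exists an independent set of vertices $V_c\subseteq V_G$ which separates $G$ (i.e., the subgraph of $G$ induced by $V_G\setminus V_c$ is disconnected), then $G$ has a NAC-coloring.
   Context: A coloring $\delta\colon E_G\to\{\text{blue},\text{red}\}$ is a NAC-coloring if it is surjective and $G$ contains no cycle with exactly one blue edge and no cycle with exactly one red edge. A set of vertices is independent if no two of its vertices are adjacent. *)

(* Defs.v *)
(* A finite simple graph is a symmetric irreflexive relation
   on a finType of vertices. *)
From mathcomp Require Import all_boot.

Set Implicit Arguments.
Unset Strict Implicit.
Unset Printing Implicit Defensive.

Inductive color := Blue | Red.

Definition is_blue (k : color) : bool := if k is Blue then true else false.
Definition is_red (k : color) : bool := if k is Red then true else false.

Section Graphs.

Variables (T : finType) (e : rel T).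

Definition edge_set : {set {set T}} :=
  [set [set p.1; p.2] | p : T * T & e p.1 p.2].

Definition edge := {a : {set T} | a \in edge_set}.

(* The graph without vertices counts as connected, so a set of vertices
   containing every vertex does not separate. *)
Definition connected_graph : Prop := forall x y : T, connect e x y.

Definition induced (S : {set T}) : rel {x : T | x \in S} :=
  fun x y => e (val x) (val y).

Definition independent (S : {set T}) : Prop :=
  forall x y : T, x \in S -> y \in S -> ~~ e x y.

(* The bound on the size excludes the degenerate closed walk [:: x; y] that
   traverses a single edge back and forth. *)
Definition graph_cycle (c : seq T) : Prop :=
  [/\ 2 < size c, uniq c & cycle e c].

Definition cycle_edges (c : seq T) : {set {set T}} :=
  [set [set x; next c x] | x in c].

Definition NAC_coloring (delta : edge -> color) : Prop :=
  [/\ forall k : color, exists a : edge, delta a = k,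
      forall c : seq T, graph_cycle c ->
        #|[set a : edge | (val a \in cycle_edges c) && is_blue (delta a)]| <> 1
    & forall c : seq T, graph_cycle c ->
        #|[set a : edge | (val a \in cycle_edges c) && is_red (delta a)]| <> 1].

End Graphs.

Definition separates (T : finType) (e : rel T) (S : {set T}) : Prop :=
  ~ connected_graph (@induced T e (~: S)).

(* Main.v *)
(* If A is a connected component of G - Vc, colour blue the edges that meet A.
   At a vertex outside Vc all incident edges then have the same colour.  Every
   edge of a cycle has an end outside Vc because Vc is independent, so one of
   its two neighbouring edges in the cycle has its colour. *)
Require Import Defs.
From mathcomp Require Import all_boot.

(** Once [c] is rotated to start at [x], two steps lead to its third entry, which exists and differs
    from [x]. This is what makes the two edges of a cycle at a common vertex distinct. *)
Lemma next_next_neq (T : eqType) (c : seq T) (x : T) :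
  2 < size c -> uniq c -> x \in c -> next c (next c x) != x.
Proof.
move=> c_gt2 c_uniq xc; have [i p c_eq] := rot_to xc.
rewrite -!(next_rot i c_uniq) c_eq.
have : uniq (x :: p) by rewrite -c_eq rot_uniq.
have : 2 < size (x :: p) by rewrite -c_eq size_rot.
case: p {c_eq} => [|y [|z p]] //= _.
rewrite !inE !negb_or eqxx => /andP[/and3P[xy xz _] _].
by rewrite [y == x]eq_sym (negPf xy) eqxx eq_sym.
Qed.

Lemma connect_neighbour (T : finType) (e : rel T) (x y : T) :
  connect e x y -> x != y -> exists z, e x z.
Proof.
case/connectP=> [[|z p]] /= => [_ -> | /andP[xz _] _ _]; first by rewrite eqxx.
by exists z.
Qed.

Section LocallyMonochromatic.

Variables (T : finType) (e : rel T) (S : {set T}) (p : pred {set T}).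
Hypothesis e_sym : symmetric e.
Hypothesis S_ind : independent e S.
Hypothesis p_local : forall u v w,
  w \notin S -> e w u -> e w v -> p [set w; u] = p [set w; v].

(** [p] stays abstract because [p_local] survives negation: one argument then serves both
    colours. *)
Lemma cycle_card_neq1 (c : seq T) : graph_cycle e c ->
  #|[set a : edge e | (val a \in cycle_edges c) && p (val a)]| <> 1.
Proof.
case=> c_gt2 c_uniq c_cycle.
move/eqP/cards1P=> [a a_only].
have next_e x : x \in c -> e x (next c x) by exact: next_cycle.
have only x : x \in c -> p [set x; next c x] -> val a = [set x; next c x].
  move=> xc px.
  have xE : [set x; next c x] \in edge_set e.
    by apply/imsetP; exists (x, next c x) => //; rewrite inE; exact: next_e.
  have : Sub [set x; next c x] xE \in [set a].
    by rewrite -a_only inE SubK px andbT; apply/imsetP; exists x.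
  by move/set1P <-; rewrite SubK.
(* By [p_local] both cycle edges at [next c x] satisfy [p], so both equal [a]. Comparing their ends
   forces [next c (next c x) = x]. *)
have no_turn x : x \in c -> next c x \notin S ->
    p [set x; next c x] || p [set next c x; next c (next c x)] -> False.
  move=> xc xS.
  have nxc : next c x \in c by rewrite mem_next.
  have nx_e : e (next c x) x by rewrite e_sym next_e.
  have := p_local _ _ _ xS nx_e (next_e _ nxc).
  rewrite [[set next c x; x]]setUC => <-; rewrite orbb => px.
  have := only _ nxc.
  rewrite -(p_local _ _ _ xS nx_e (next_e _ nxc)) setUC => /(_ px).
  rewrite (only _ xc px) => /setP /(_ x).
  rewrite !inE eqxx => /esym/orP x_next.
  case/eqP: (next_next_neq T c x c_gt2 c_uniq xc).
  by case: x_next => /eqP x_eq; rewrite -!x_eq.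
have : a \in [set a] by rewrite set11.
rewrite -a_only inE => /andP[/imsetP[x xc ->] px].
(* The turn is taken at an end of the edge outside [S]: at [next c x] if [x] lies in [S], otherwise
   at [x], seen as the successor of [prev c x]. *)
have [xS|xS] := boolP (x \in S).
  apply: (no_turn x); rewrite ?px //.
  by apply/negP => nxS; have := S_ind _ _ xS nxS; rewrite next_e.
apply: (no_turn (prev c x)); rewrite ?mem_prev ?next_prev //.
by rewrite px orbT.
Qed.

End LocallyMonochromatic.

Theorem theorem3 (T : finType) (e : rel T)
  (e_sym : symmetric e) (e_irr : irreflexive e)
  (e_conn : connected_graph e) :
  (exists Vc : {set T}, independent e Vc /\ separates e Vc) ->
  exists delta : edge e -> color, NAC_coloring delta.
Proof.
case=> S [S_ind S_sep].
(* Finiteness makes connectedness decidable, so its negation yields an explicit pair. *)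
have [x [y xy]] : exists x y, ~~ connect (@induced T e (~: S)) x y.
  have [/forallP all_conn|] :=
    boolP [forall x, forall y, connect (@induced T e (~: S)) x y].
    by case: S_sep => x y; exact: (forallP (all_conn x)).
  by case/forallPn=> x /forallPn[y xy]; exists x, y.
pose A := [set val z | z in connect (@induced T e (~: S)) x].
have A_closed u w : w \notin S -> e w u -> u \in A -> w \in A.
  move=> wS wu /imsetP[z xz u_eq].
  have wS' : w \in ~: S by rewrite inE.
  apply/imsetP; exists (Sub w wS'); last by rewrite SubK.
  apply: connect_trans xz (connect1 _).
  by rewrite /induced SubK -u_eq e_sym.
pose p := [pred a : {set T} | [exists z in a, z \in A]].
(* The value does not depend on [u], which gives [p_local] for [p] and for its negation. *)
have pE w u : w \notin S -> e w u -> p [set w; u] = (w \in A).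
  move=> wS wu; apply/exists_inP/idP => [[z]|wA]; last by exists w; rewrite ?set21.
  by case/set2P=> -> //; exact: A_closed.
have xA : val x \in A by apply/imsetP; exists x => //; exact: connect0.
have yA : val y \notin A.
  by apply/imsetP=> -[z xz /val_inj yz]; case/negP: xy; rewrite yz.
(* For surjectivity: connectedness of the whole graph gives [v] an incident edge, coloured according
   to [v]. Taking [v] to be [x] yields blue, and [y] yields red. *)
have edge_at (v w : {v | v \in ~: S}) : val v != val w ->
    exists a : edge e, p (val a) = (val v \in A).
  move=> vw; have [u vu] := connect_neighbour _ _ _ _ (e_conn (val v) (val w)) vw.
  have aE : [set val v; u] \in edge_set e.
    by apply/imsetP; exists (val v, u); rewrite ?inE.
  by exists (exist _ [set val v; u] aE); rewrite [val _]/= pE //; have := valP v; rewrite inE.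
have neq_xy : val x != val y by apply: contraNneq yA => <-.
pose delta (a : edge e) := if p (val a) then Blue else Red.
exists delta; split=> [[]|c c_cyc|c c_cyc].
- have [a pa] := edge_at x y neq_xy.
  by exists a; rewrite /delta pa xA.
- have [|a pa] := edge_at y x; first by rewrite eq_sym.
  by exists a; rewrite /delta pa (negPf yA).
- have -> : [set a | (val a \in cycle_edges c) && is_blue (delta a)] =
      [set a : edge e | (val a \in cycle_edges c) && p (val a)].
    by apply: eq_finset => a; rewrite /delta; case: (p _).
  apply: (cycle_card_neq1 T e S p e_sym S_ind _ c c_cyc) => u v w wS wu wv.
  by rewrite !pE.
- have -> : [set a | (val a \in cycle_edges c) && is_red (delta a)] =
      [set a : edge e | (val a \in cycle_edges c) && ~~ p (val a)].
    by apply: eq_finset => a; rewrite /delta; case: (p _).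
  apply: (cycle_card_neq1 T e S (fun a => ~~ p a) e_sym S_ind _ c c_cyc).
  by move=> u v w wS wu wv; rewrite !pE.
Qed.
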